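(* Let $C_n$ be a cycle with $n$ vertices and let $p$ be a positive integer. Then $C_n$ is a $p$-competition graph if and only if $n \geq p+3$.
   Context: A digraph $D=(V,A)$ consists of a finite vertex set $V$ and an arc set $A \subseteq V \times V$ (loops are allowed). For a positive integer $p$, the $p$-competition graph $C_p(D)$ of a digraph $D=(V,A)$ is the simple undirected graph with the same vertex set $V$ in which two distinct vertices $x,y \in V$ are adjacent if and only if there exist $p$ distinct vertices $v_1,\ldots,v_p \in V$ such that $(x,v_i),(y,v_i) \in A$ for each $i=1,\ldots,p$. A graph $G$ is called a $p$-competition graph if there exists a digraph $D$ such that $C_p(D)=G$ (so $D$ has the same vertex set as $G$). The cycle $C_n$ has vertex set $\{v_0,\ldots,v_{n-1}\}$ and edge set $\{v_iv_{i+1} \mid i=0,\ldots,n-1\}$, with subscripts taken modulo $n$.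
   Formalization: The formal theorem assumes n ≥ 4; the claim fails for the triangle n = 3, since C_3 = K_3 is a p-competition graph for p = 1, 2, 3 (take all arcs, A = V × V) although 3 < p + 3. *)

(* Defs.v *)
From mathcomp Require Import all_boot.

Set Implicit Arguments.
Unset Strict Implicit.
Unset Printing Implicit Defensive.

Record sgraph (V : finType) := SGraph {
  adj :> rel V;
  adj_sym : symmetric adj;
  adj_irr : irreflexive adj }.

Definition digraph (V : finType) := {set V * V}.

Section PCompetition.
Variables (p : nat) (V : finType).

(* The entries of the duplicate-free tuple are the p distinct common
   out-neighbours; they may coincide with x or y, since D may have loops. *)
Definition p_comp_adj (D : digraph V) : rel V := fun x y =>
  (x != y) &&
  [exists t : p.-tuple V,
    uniq t && all (fun v => ((x, v) \in D) && ((y, v) \in D)) t].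

Lemma p_comp_adj_sym (D : digraph V) : symmetric (p_comp_adj D).
Proof.
move=> x y; rewrite /p_comp_adj eq_sym; congr (_ && _).
apply: eq_existsb => t; congr (_ && _).
by apply: eq_all => v; rewrite andbC.
Qed.

Lemma p_comp_adj_irr (D : digraph V) : irreflexive (p_comp_adj D).
Proof. by move=> x; rewrite /p_comp_adj eqxx. Qed.

Definition p_competition_graph_of (D : digraph V) : sgraph V :=
  SGraph (p_comp_adj_sym D) (p_comp_adj_irr D).

Definition p_competition_graph (G : sgraph V) : Prop :=
  exists D : digraph V, p_competition_graph_of D =2 G.

End PCompetition.

(* ordS i is i + 1 modulo n. The conjunct i != j is redundant for n >= 2; it
   only removes the loop that the formula would give for n = 1. *)
Definition cycle_adj (n : nat) : rel 'I_n := fun i j =>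
  (i != j) && ((j == ordS i) || (i == ordS j)).

Lemma cycle_adj_sym n : symmetric (@cycle_adj n).
Proof. by move=> i j; rewrite /cycle_adj eq_sym orbC. Qed.

Lemma cycle_adj_irr n : irreflexive (@cycle_adj n).
Proof. by move=> i; rewrite /cycle_adj eqxx. Qed.

Definition cycle_graph (n : nat) : sgraph 'I_n :=
  SGraph (@cycle_adj_sym n) (@cycle_adj_irr n).

(* Main.v *)
Require Import Defs.
From mathcomp Require Import all_boot.
From mathcomp Require Import zify.

Set Implicit Arguments.
Unset Strict Implicit.

(** Let [S i] be the out-neighbourhood of vertex [i].  For [p + 3 <= n] the arcs
    [S i = {i, ..., i + p}] realise the cycle.  Conversely, put [m = n - p] and
    pass to complements [T i = ~: S i]: unions of cyclically consecutive [T]'s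
    have at most [m] elements, and unions of non-adjacent ones more than [m].
    If [m <= 2] and [#|T a| <= 1], then on a path [a, b, c, d] these bounds force
    [T b] to be nonempty, contained in [T c = T d] and disjoint from [T d].  So
    every [T i] has exactly two elements, and consecutive ones coincide, which
    is absurd. *)

Definition out_nbhd (V : finType) (D : digraph V) (x : V) : {set V} :=
  [set v | (x, v) \in D].

(** Trades the tuple of witnesses for a cardinality, the form used in both directions. *)
Lemma p_comp_adjE (p : nat) (V : finType) (D : digraph V) (x y : V) :
  p_comp_adj p D x y =
  (x != y) && (p <= #|out_nbhd D x :&: out_nbhd D y|).
Proof.
congr (_ && _); apply/existsP/idP => [[t /andP[Ut /allP tP]]|le_p].
  rewrite -(size_tuple t) -(card_uniqP Ut); apply/subset_leq_card/subsetP => v.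
  by rewrite !inE => /tP.
have sz : size (take p (enum (out_nbhd D x :&: out_nbhd D y))) == p.
  by rewrite size_takel // -cardE.
exists (Tuple sz); rewrite take_uniq ?enum_uniq //=.
by apply/allP => v /mem_take; rewrite mem_enum !inE.
Qed.

Lemma cardsCI (T : finType) (A B : {set T}) :
  #|~: A :|: ~: B| + #|A :&: B| = #|T|.
Proof. by rewrite -setCI addnC cardsC. Qed.

Lemma no_path4_small_head (T : finType) (m : nat) (A B C D : {set T}) :
    m <= 2 -> #|A| <= 1 ->
    #|A :|: B| <= m -> #|B :|: C| <= m -> #|C :|: D| <= m ->
    m < #|A :|: C| -> m < #|B :|: D| -> False.
Proof.
move=> m2 A1 AB BC CD AC BD.
have cC : #|C| <= m := leq_trans (subset_leq_card (subsetUr B C)) BC.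
have cD : #|D| <= m := leq_trans (subset_leq_card (subsetUr C D)) CD.
have eAC := cardsUI A C; have eBD := cardsUI B D; have eAB := cardsUI A B.
(* [A] adds at most one element to [C], yet [A :|: C] exceeds [m]: so [C] has [m] elements and [A]
   is a single point outside it. *)
have cC_m : #|C| = m by lia.
have AC0 : #|A :&: C| = 0 by lia.
have BsC : B \subset C.
  by apply/setUidPr/eqP; rewrite eq_sym eqEcard subsetUr cC_m.
have AB0 : #|A :&: B| = 0.
  by apply/eqP; rewrite -leqn0 -AC0; apply/subset_leq_card/setIS.
(* [B] is disjoint from the singleton [A], so [#|B| <= m - 1 <= 1]; as [B :|: D] exceeds [m], [D]
   has at least [2 >= m] elements. *)
have cD_m : #|D| = m by lia.
have CD_eq : C = D.
  have sub X Y : #|X :|: Y| <= m -> #|Y| = m -> X \subset Y.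
    move=> le_m eYm; apply/setUidPr/eqP.
    by rewrite eq_sym eqEcard subsetUr eYm.
  by apply/eqP; rewrite eqEsubset !sub // setUC.
have := setUidPr BsC; rewrite CD_eq => BDD; move: BD; rewrite BDD; lia.
Qed.

Lemma ord_eqE (n : nat) (i j : 'I_n) : (i == j) = (i == j :> nat).
Proof. by []. Qed.

Lemma ordSE (n : nat) (i : 'I_n) :
  ordS i = (if i.+1 < n then i.+1 else 0) :> nat.
Proof.
rewrite /=; case: ltnP => [/modn_small //|le_n].
by have -> : i.+1 = n; [have := ltn_ord i; lia | rewrite modnn].
Qed.

Lemma cycle_adj_ordS (n : nat) (i : 'I_n) : 1 < n -> cycle_adj i (ordS i).
Proof.
move=> n_gt1; rewrite /cycle_adj eqxx andbT ord_eqE ordSE.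
by have := ltn_ord i; case: ifP; lia.
Qed.

Lemma ordS2_neq (n : nat) (i : 'I_n) : 2 < n -> i != ordS (ordS i).
Proof.
move=> n_gt2; rewrite ord_eqE ordSE ordSE.
by have := ltn_ord i; do !case: ifP; lia.
Qed.

(** In a triangle two steps forward are one step back, hence [3 < n]. *)
Lemma cycle_nadj_ordS2 (n : nat) (i : 'I_n) :
  3 < n -> cycle_adj i (ordS (ordS i)) = false.
Proof.
move=> n_gt3; apply/negbTE; rewrite /cycle_adj (ordS2_neq i (ltnW n_gt3)) /=.
rewrite !ord_eqE !ordSE.
by have := ltn_ord i; do !case: ifP; lia.
Qed.

Lemma cycle_p_competition_lower (n p : nat) :
  3 < n -> p_competition_graph p (cycle_graph n) -> p + 3 <= n.
Proof.
move=> n_gt3 [D DE]; case: (leqP (p + 3) n) => // n_lt; exfalso.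
have n0 : 0 < n by lia.
pose T i := ~: out_nbhd D i; pose m := n - p.
have adjE i j : cycle_adj i j =
    (i != j) && (p <= #|out_nbhd D i :&: out_nbhd D j|).
  by rewrite -p_comp_adjE; apply: esym (DE i j).
have TI i j : #|T i :|: T j| + #|out_nbhd D i :&: out_nbhd D j| = n.
  by rewrite cardsCI card_ord.
have consec i : #|T i :|: T (ordS i)| <= m.
  have := TI i (ordS i); have := cycle_adj_ordS i (ltnW (ltnW n_gt3)).
  by rewrite adjE => /andP[_]; lia.
have apart i : m < #|T i :|: T (ordS (ordS i))|.
  have := cycle_nadj_ordS2 i n_gt3; rewrite adjE (ordS2_neq i (ltnW n_gt3)) andTb.
  (* The edge from [i] to [ordS i] yields [p <= n], so the truncated subtraction in [m] is exact. *)
  have := cycle_adj_ordS i (ltnW (ltnW n_gt3)); rewrite adjE => /andP[_].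
  by have := TI i (ordS i); have := TI i (ordS (ordS i)); lia.
have m2 : m <= 2 by lia.
have T_gt1 i : 1 < #|T i|.
  rewrite ltnNge; apply/negP => Ti1.
  by apply: (no_path4_small_head m2 Ti1 (consec i) (consec _) (consec _)
               (apart i) (apart _)).
(* Both sets have at least [2 >= m] elements and their union at most [m], so each equals the
   union. *)
have T_eq i : T i = T (ordS i).
  have sub (X : {set 'I_n}) : 1 < #|X| -> X \subset T i :|: T (ordS i) ->
      X = T i :|: T (ordS i).
    move=> X1 sX; apply/eqP; rewrite eqEcard sX /=.
    exact: leq_trans (consec i) (leq_trans m2 X1).
  by rewrite (sub _ (T_gt1 i) (subsetUl _ _)) -(sub _ (T_gt1 _) (subsetUr _ _)).
pose i := Ordinal n0.
by have := apart i; rewrite -T_eq ltnNge consec.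
Qed.

Section CyclicArcs.
Variable n : nat.
Implicit Types i j v : 'I_n.

(* [v - i] modulo [n]. *)
Definition offset i v : nat := if i <= v then v - i else v + n - i.

Lemma offset_lt i v : offset i v < n.
Proof.
by rewrite /offset; have := ltn_ord i; have := ltn_ord v; case: ifP; lia.
Qed.

Definition offset_ord i v : 'I_n := Ordinal (offset_lt i v).

Lemma offset_ord_inj i : injective (offset_ord i).
Proof.
move=> u v /(congr1 val) /=; rewrite /offset => e; apply: val_inj => /=.
move: e; have := ltn_ord i; have := ltn_ord u; have := ltn_ord v.
by do !case: ifP; lia.
Qed.

Lemma offset_surj i (k : 'I_n) : exists v, offset i v = k.
Proof.
have [g _ gK] := injF_bij (@offset_ord_inj i).
by exists (g k); rewrite -{2}(gK k).
Qed.

(** For [p < n], the cyclic interval from [i] to [i + p]: it has [p + 1] elements, so that a shift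
    by one still leaves [p] in common. *)
Definition arc_set p i : {set 'I_n} := [set v | offset i v <= p].

Lemma card_arc_set p i : p < n -> #|arc_set p i| = p.+1.
Proof.
move=> p_lt.
have -> : arc_set p i = offset_ord i @^-1: [set k : 'I_n | k < p.+1].
  by apply/setP => v; rewrite !inE.
rewrite card_preimset; last exact: offset_ord_inj.
by rewrite -sum1dep_card (big_ord_narrow p_lt) sum1_card card_ord.
Qed.

Lemma arc_set_consec p i : p < n -> p <= #|arc_set p i :&: arc_set p (ordS i)|.
Proof.
move=> p_lt; have := cardsID (arc_set p (ordS i)) (arc_set p i).
rewrite card_arc_set // => e.
(* The shift loses only the starting point [i]. *)
suff : #|arc_set p i :\: arc_set p (ordS i)| <= #|[set i]|.
  by rewrite cards1; lia.
apply/subset_leq_card/subsetP => v.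
rewrite !inE ord_eqE /offset ordSE.
by have := ltn_ord i; have := ltn_ord v; do !case: ifP; lia.
Qed.

Lemma arc_set_apart p i j : 0 < p -> p + 3 <= n ->
  i != j -> j != ordS i -> i != ordS j ->
  #|arc_set p i :&: arc_set p j| < p.
Proof.
move=> p_gt0 n_ge neq_ij neq_jS neq_iS; have p_lt : p < n by lia.
(* [e] and [e + 1] are the first two offsets from [i] that [arc_set p j]
   misses. *)
pose d := offset i j; pose e := d + p.+1 - n.
have d_lt : d < n := offset_lt i j.
have [d_gt1 d_ltn1] : 1 < d /\ d.+1 < n.
  move: neq_ij neq_jS neq_iS; rewrite !ord_eqE !ordSE /d /offset.
  by have := ltn_ord i; have := ltn_ord j; do !case: ifP; lia.
have e_lt : e < n by lia.
have e1_lt : e.+1 < n by lia.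
have [u /= uE] := offset_surj i (Ordinal e_lt).
have [v /= vE] := offset_surj i (Ordinal e1_lt).
have neq_uv : u != v by apply/eqP => uv; move: vE; rewrite -uv uE; lia.
(* If [d + p < n], then [e = 0], and the offsets 0 and 1 precede [d >= 2]. Otherwise the second
   interval wraps round and ends at offset [e - 1]; then [e.+1 < d] by [p + 3 <= n], and [e.+1 <= p]
   by [d <= n - 2]. *)
have out w : offset i w = e \/ offset i w = e.+1 ->
    w \in arc_set p i :\: arc_set p j.
  rewrite !inE; move: d_gt1 d_ltn1; rewrite /e /d /offset.
  by have := ltn_ord i; have := ltn_ord j; have := ltn_ord w; do !case: ifP; lia.
have : #|[set u; v]| <= #|arc_set p i :\: arc_set p j|.
  apply/subset_leq_card/subsetP => w; rewrite !inE => /orP[]/eqP->.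
    by move: (out u); rewrite !inE; apply; left.
  by move: (out v); rewrite !inE; apply; right.
rewrite cards2 neq_uv => diff_gt1.
have := cardsID (arc_set p j) (arc_set p i); rewrite card_arc_set //.
by move: diff_gt1 => /=; lia.
Qed.

End CyclicArcs.

Lemma cycle_p_competition (n p : nat) :
  0 < p -> p + 3 <= n -> p_competition_graph p (cycle_graph n).
Proof.
move=> p_gt0 n_ge; exists [set xy | xy.2 \in arc_set p xy.1] => i j /=.
have outE x : out_nbhd [set xy | xy.2 \in arc_set p xy.1] x =
    arc_set p x :> {set 'I_n}.
  by apply/setP => v; rewrite !inE.
rewrite p_comp_adjE !outE /cycle_adj.
have [//|neq_ij /=] := eqVneq i j.
have p_lt : p < n by lia.
have [->|neq_jS] := eqVneq j (ordS i); first by rewrite arc_set_consec.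
have [->|neq_iS] := eqVneq i (ordS j); first by rewrite setIC arc_set_consec.
by apply/negbTE; rewrite -ltnNge arc_set_apart.
Qed.

(* n >= 4: the equivalence fails for the triangle C_3 = K_3, which is a
   p-competition graph for p = 1, 2, 3. *)
Theorem theorem2p3 (n p : nat) (hn : 4 <= n) (hp : 0 < p) :
  p_competition_graph p (cycle_graph n) <-> p + 3 <= n.
Proof.
split; first exact: cycle_p_competition_lower.
exact: cycle_p_competition.
Qed.
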